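(* Let $r\ge 2$ and let $\mathcal{H}$ be an $r$-graph. (a) If $\mathcal{H}$ contains distinct vertices $u$ and $v$ that are contained in exactly the same edges, then the eigenvalues of $\mathcal{H}\triangleleft v$ are also eigenvalues of $\mathcal{H}$. (b) If $\mathcal{H}$ contains a vertex $v$ such that every edge containing $v$ has a vertex of degree $1$ other than $v$, then the eigenvalues of $\mathcal{H}\triangleleft v$ are also eigenvalues of $\mathcal{H}$.
   Context: An $r$-graph is a finite hypergraph $\mathcal{H}=(V,E)$ all of whose edges are $r$-element subsets of $V$. The degree of a vertex is the number of edges containing it; a vertex of degree zero is isolated. For a vertex $v$, $\mathcal{H}\triangleleft v$ denotes the subgraph of $\mathcal{H}$ obtained by removing $v$, all edges containing $v$, and all vertices that become isolated when these edges are deleted. Eigenvalues of an $r$-graph $\mathcal{H}$ on $n$ vertices are those of its adjacency tensor (dimension $n$, order $r$, entries $a_{i_1\dots i_r}=\frac{1}{(r-1)!}$ if $\{i_1,\dots,i_r\}\in E(\mathcal{H})$ and $0$ otherwise): $\lambda\in\mathbb{C}$ is an eigenvalue if there is a nonzero $\mathbf{x}\in\mathbb{C}^n$ with $\sum_{i_2,\dots,i_r=1}^n a_{ii_2\dots i_r}x_{i_2}\cdots x_{i_r}=\lambda x_i^{r-1}$ for all $i$; equivalently, $\sum_{e\in E(\mathcal{H}),\, i\in e}\ \prod_{j\in e\setminus\{i\}}x_j=\lambda x_i^{r-1}$ for every vertex $i$. *)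

(* Defs.v *)
From mathcomp Require Import all_boot all_order all_algebra.
From mathcomp Require Import reals complex.
Set Implicit Arguments.
Unset Strict Implicit.
Unset Printing Implicit Defensive.
Import GRing.Theory.
Local Open Scope ring_scope.

(* r-uniform hypergraphs. The vertex set is a subset of an ambient finite type, so that a graph and
   its subgraphs live over the same type. *)
Record hypergraph (r : nat) (T : finType) := Hypergraph {
  vertices : {set T};
  edges : {set {set T}};
  edge_vertices : forall e, e \in edges -> e \subset vertices;
  edge_uniform : forall e, e \in edges -> #|e| = r
}.

Definition degree (r : nat) (T : finType) (H : hypergraph r T) (w : T) : nat :=
  #|[set e in edges H | w \in e]|.

Section Deletion.
Variables (r : nat) (T : finType) (H : hypergraph r T) (v : T).

Definition del_edges : {set {set T}} := [set e in edges H | v \notin e].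

(* Only the vertices that become isolated are removed: a vertex other than v
   that is already isolated in H is kept. *)
Definition del_vertices : {set T} :=
  [set w in vertices H | (w != v) &&
     ~~ ((0 < degree H w)%N && [forall e in del_edges, w \notin e])].

Fact del_edge_vertices e : e \in del_edges -> e \subset del_vertices.
Proof.
move=> eD; have := eD; rewrite inE => /andP[eE vNe].
apply/subsetP => w we; rewrite inE (subsetP (edge_vertices eE)) //=.
rewrite (contraTneq _ we) => [|->] //=; rewrite negb_and orbC.
by apply/orP; left; apply/negP => /forall_inP/(_ e eD); rewrite we.
Qed.

Fact del_edge_uniform e : e \in del_edges -> #|e| = r.
Proof. by rewrite inE => /andP[eE _]; apply: edge_uniform eE. Qed.

Definition del_vertex : hypergraph r T := Hypergraph del_edge_vertices del_edge_uniform.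

End Deletion.

(* A tensor of order r >= 1 and dimension n; the first index is kept separate
   from the other r - 1, so the entry a_(i, i_2, ..., i_r) is A i t with
   t = (i_2, ..., i_r). *)
Definition tensor (C : Type) (r n : nat) : Type :=
  'I_n -> (r.-1).-tuple 'I_n -> C.

Definition tensor_eigenvalue (C : fieldType) (r n : nat) (A : tensor C r n)
    (lambda : C) : Prop :=
  exists2 x : 'rV[C]_n, x != 0 &
    forall i : 'I_n,
      \sum_(t : (r.-1).-tuple 'I_n) A i t * \prod_(j <- t) x 0 j
        = lambda * x 0 i ^+ r.-1.

(* The vertices are numbered by the library enumeration enum_val. *)
Definition adjacency_tensor (C : fieldType) (r : nat) (T : finType)
    (H : hypergraph r T) : tensor C r #|vertices H| :=
  fun i t => if [set enum_val j | j in i :: t] \in edges H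
             then ((r.-1)`!%:R)^-1 else 0.
Arguments adjacency_tensor C {r T} H _ _.

Definition hypergraph_eigenvalue (R : realType) (r : nat) (T : finType)
    (H : hypergraph r T) (lambda : R[i]) : Prop :=
  tensor_eigenvalue (adjacency_tensor R[i] H) lambda.

(* Main.v *)
Require Import Defs.
From mathcomp Require Import all_boot all_order all_algebra.
From mathcomp Require Import reals complex.

(** An eigenvector of [H] with [v] deleted, extended by zero, is an eigenvector
    of [H] for the same eigenvalue: each edge through [v] also contains a second
    removed vertex, so in every eigenvalue equation of [H] its product has a
    vanishing factor. *)

Set Implicit Arguments.
Unset Strict Implicit.
Unset Printing Implicit Defensive.
Import GRing.Theory.

(** The eigenvector of [B] is extended by zero along [f]. In a row inside the image of [f], tuples
    leaving the image contribute a zero factor, and the others reproduce the equation of [B]. In a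
    row outside it, the entries that could meet a nonzero product vanish by assumption. *)
Lemma tensor_eigenvalue_extend (C : fieldType) (r m n : nat)
    (f : 'I_m -> 'I_n) (A : tensor C r n) (B : tensor C r m) (lambda : C) :
  1 < r -> injective f ->
  (forall i t, B i t = A (f i) (map_tuple f t)) ->
  (forall i (t : (r.-1).-tuple 'I_n), i \notin codom f ->
     {subset t <= codom f} -> A i t = 0%R) ->
  tensor_eigenvalue B lambda -> tensor_eigenvalue A lambda.
Proof.
move=> r_gt1 injf BE A0 [x x0 xP].
(* As [f] is injective, the sum has at most one term; off the image it is empty, hence zero. *)
pose y : 'rV[C]_n := (\row_j \sum_(k | f k == j) x 0 k)%R.
have yf k : y 0%R (f k) = x 0%R k.
  by rewrite mxE (big_pred1 k) // => l; rewrite /= (inj_eq injf).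
have y0 j : j \notin codom f -> y 0%R j = 0%R.
  move=> jf; rewrite mxE big_pred0 // => k; apply: contraNF jf => /eqP <-.
  exact: codom_f.
have prod0 (t : (r.-1).-tuple 'I_n) : ~~ all [in codom f] t ->
    (\prod_(j <- t) y 0 j = 0)%R.
  case/allPn => j jt jf; apply/eqP; rewrite prodf_seq_eq0.
  by apply/hasP; exists j => //=; rewrite y0.
exists y => [|i].
  apply: contra_neq x0 => yE; apply/rowP => k.
  by rewrite -yf yE !mxE.
have [/codomP[k ->]|iNf] := boolP (i \in codom f); last first.
  (* The right-hand side is [lambda * 0 ^+ r.-1], which is zero only for a positive exponent. *)
  have r1_gt0 : 0 < r.-1 by rewrite -ltnS prednK // ltnW.
  rewrite y0 // expr0n (gtn_eqF r1_gt0) mulr0 big1 // => t _.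
  have [/allP tf|/prod0 ->] := boolP (all [in codom f] t).
    by rewrite A0 ?mul0r.
  by rewrite mulr0.
have injmap : injective (map_tuple f : (r.-1).-tuple 'I_m -> _).
  by move=> s t /(congr1 val)/(inj_map injf)/val_inj.
rewrite yf -xP (bigID [in [set map_tuple f s | s in {: (r.-1).-tuple 'I_m}]]) /=.
rewrite addrC big1 ?add0r => [|t tNf]; last first.
  rewrite prod0 ?mulr0 //; apply: contra tNf => tf.
  (* A tuple with all entries in the image is lifted entry by entry. *)
  have [s sE] : exists s, map f s = t.
    elim: (val t) tf => [|j s IH] /=; first by exists [::].
    by case/andP => /codomP[l ->] /IH[s' <-]; exists (l :: s').
  have ss : size s == r.-1 by rewrite -(size_map f) sE size_tuple.
  apply/imsetP; exists (Tuple ss) => //.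
  exact/val_inj.
rewrite big_imset /=; last by move=> s t _ _; apply: injmap.
apply: eq_bigr => s _; rewrite BE big_map.
by congr (_ * _)%R; apply: eq_bigr => j _; rewrite yf.
Qed.

Section DeleteVertex.

Variables (R : realType) (r : nat) (T : finType) (H : hypergraph r T) (v : T).

(** An edge avoiding [v] survives the deletion and keeps all its vertices. *)
Lemma edge_through_removed (e : {set T}) (w : T) :
  e \in edges H -> w \in e -> w \notin vertices (del_vertex H v) -> v \in e.
Proof.
move=> eH we; apply: contraNT => vNe.
have eD : e \in del_edges H v by rewrite inE eH.
exact: subsetP (del_edge_vertices eD) w we.
Qed.

(** The edge [e] gives [w] positive degree, so [w] becomes isolated rather than being isolated from
    the start, in which case it would be kept. *)
Lemma vertex_removed (w : T) (e : {set T}) : e \in edges H -> w \in e ->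
  (forall e', e' \in edges H -> w \in e' -> v \in e') ->
  w \notin vertices (del_vertex H v).
Proof.
move=> eH we wv; rewrite inE; apply/negP => /and3P[_ _ /negP[]].
apply/andP; split; first by apply/card_gt0P; exists e; rewrite inE eH.
apply/forall_inP => e'; rewrite inE => /andP[e'H vNe'].
by apply: contra vNe' => /(wv _ e'H).
Qed.

(** Common core of both parts: no edge has exactly one removed vertex, which is the vanishing
    condition of [tensor_eigenvalue_extend]. *)
Lemma eigenvalue_del_vertex (lambda : R[i]) : 1 < r ->
  (forall e, e \in edges H -> v \in e ->
     exists w, [/\ w \in e, w <> v & w \notin vertices (del_vertex H v)]) ->
  hypergraph_eigenvalue (del_vertex H v) lambda -> hypergraph_eigenvalue H lambda.
Proof.
move=> r_gt1 removed2; set V := vertices H; set V' := vertices (del_vertex H v).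
have vNV' : v \notin V' by rewrite inE eqxx /= andbF.
have subV w : w \in V' -> w \in V by rewrite inE => /andP[].
pose f (k : 'I_#|V'|) : 'I_#|V| :=
  enum_rank_in (subV _ (enum_valP k)) (enum_val k).
have fE k : enum_val (f k) = enum_val k.
  by rewrite enum_rankK_in ?subV ?enum_valP.
have injf : injective f.
  by move=> k l /(congr1 enum_val); rewrite !fE => /enum_val_inj.
have codomE j : (j \in codom f) = (enum_val j \in V').
  apply/codomP/idP => [[k ->]|jV']; first by rewrite fE enum_valP.
  by exists (enum_rank_in jV' (enum_val j)); apply: enum_val_inj;
    rewrite fE enum_rankK_in.
apply: (@tensor_eigenvalue_extend _ _ _ _ f) => // [i t|i t iNf tf].
  rewrite /adjacency_tensor.
  have -> : [set enum_val j | j in f i :: map_tuple f t]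
          = [set enum_val j | j in i :: t].
    apply/setP => w; apply/imsetP/imsetP => -[j jt ->].
      by have /mapP[k kt ->] : j \in map f (i :: t) by []; exists k; rewrite ?fE.
    by exists (f j); rewrite ?fE //; apply: (map_f f (s := i :: t)).
  (* All vertices indexed by [i :: t] are kept, so [v] is not among them, and such a set is an edge
     after deletion iff it is one in [H]. *)
  rewrite inE andbC; case: imsetP => //= -[j _ vE].
  by rewrite vE enum_valP in vNV'.
rewrite /adjacency_tensor; case: ifP => // eH.
(* Since [t] stays among kept vertices, only [i] can index a removed one; yet [v] and [w] are two of
   them. *)
have in_e w : w \in [set enum_val j | j in i :: t] -> w \notin V' ->
    w = enum_val i.
  case/imsetP => j; rewrite inE => /orP[/eqP->//|/tf].
  by rewrite codomE => jV' ->; rewrite jV'.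
have ie : enum_val i \in [set enum_val j | j in i :: t].
  by apply: imset_f; rewrite inE eqxx.
have ve : v \in [set enum_val j | j in i :: t].
  by apply: edge_through_removed eH ie _; rewrite -codomE.
have [w [we wv wNV']] := removed2 _ eH ve.
by case: wv; rewrite (in_e w) // (in_e v).
Qed.

End DeleteVertex.

Theorem theorem5 (R : realType) (r : nat) (hr : 2 <= r) (T : finType)
    (H : hypergraph r T) :
  (forall u v : T, u \in vertices H -> v \in vertices H -> u <> v ->
     (forall e : {set T}, e \in edges H -> (u \in e <-> v \in e)) ->
     forall lambda : R[i],
       hypergraph_eigenvalue (del_vertex H v) lambda -> hypergraph_eigenvalue H lambda)
  /\
  (forall v : T, v \in vertices H ->
     (forall e : {set T}, e \in edges H -> v \in e ->
        exists w : T, [/\ w \in e, w <> v & degree H w = 1]) ->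
     forall lambda : R[i],
       hypergraph_eigenvalue (del_vertex H v) lambda -> hypergraph_eigenvalue H lambda).
Proof.
(* For twins the second removed vertex is [u]; in the other case it is the degree-one vertex, whose
   only edge [e0] contains [v]. *)
split=> [u v _ _ uv twin|v _ leaf] lambda; apply: eigenvalue_del_vertex => // e eH ve.
  have ue : u \in e by apply/twin.
  exists u; split=> //; apply: (vertex_removed eH ue) => e' e'H.
  by case: (twin e' e'H).
have [w [we wv /eqP/cards1P[e0 degw]]] := leaf e eH ve.
have e0P e' : e' \in edges H -> w \in e' -> e' = e0.
  by move=> e'H we'; apply/set1P; rewrite -degw inE e'H.
exists w; split=> //; apply: (vertex_removed eH we) => e' e'H we'.
by rewrite (e0P _ e'H we') -(e0P _ eH we).
Qed.
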